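(* For a topological vector space $E$, the following assertions are equivalent: (i) for every sequence $\{U_n\}_{n\in\omega}$ of open subsets of $E$ such that $0\in\overline{U_n}$ for every $n\in\omega$, there are a strictly increasing sequence $(n_k)_{k\in\omega}\subseteq\omega$ and a sequence $\{x_k\}_{k\in\omega}$ in $E$ such that $x_k\in U_{n_k}$ for every $k\in\omega$ and $x_k\to 0$; (ii) $E$ is a $\kappa$-Fréchet--Urysohn space.
   Context: Topological vector spaces are assumed Hausdorff (hence Tychonoff). A Tychonoff space $X$ is $\kappa$-Fréchet--Urysohn if for any open set $U\subseteq X$ and each $x\in\overline{U}$ there exists a sequence in $U$ converging to $x$. *)

(* Defs.v *)
From HB Require Import structures.
From mathcomp Require Import all_boot all_order all_algebra.
From mathcomp Require Import all_classical all_reals all_analysis.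
Set Implicit Arguments.
Unset Strict Implicit.
Unset Printing Implicit Defensive.
Import Order.TTheory GRing.Theory Num.Theory.
Local Open Scope classical_set_scope.

(* [completely_regular_space] separates points from closed sets by a continuous
   real-valued function (see [uniform_separatorP]) and contains no separation
   axiom between points; hence the Hausdorff conjunct. *)
Definition tychonoff_space (X : topologicalType) : Prop :=
  hausdorff_space X /\ completely_regular_space X.

Definition kappa_frechet_urysohn (X : topologicalType) : Prop :=
  tychonoff_space X /\
  forall (U : set X) (x : X), open U -> closure U x ->
    exists2 u : nat -> X, (forall n, U (u n)) & u n @[n --> \oo] --> x.

(* Main.v *)
From HB Require Import structures.
Require Import Defs.
From mathcomp Require Import all_boot all_order all_algebra.
From mathcomp Require Import all_classical all_reals all_analysis.
Import Order.TTheory GRing.Theory Num.Theory.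
Local Open Scope classical_set_scope.
Local Open Scope ring_scope.

(** The argument is about a Hausdorff topological abelian group.

    The implication from the diagonal property at 0 to the kappa-Frechet-Urysohn
    property is homogeneity: for U open and x in its closure, the constant
    sequence equal to U - x consists of open sets adherent to 0, and translating
    back by x the null sequence that it yields gives a sequence in U converging
    to x. The Tychonoff half of the definition is the classical fact that the
    sets of pairs (x, y) with y - x in a fixed neighbourhood of 0 form a
    uniformity inducing the topology
    ([topologicalZmod_completely_regular]).

    For the converse, the difficulty is that a sequence extracted from a single
    open set must be forced to visit infinitely many of the U_n. If 0 is isolated
    then 0 lies in every U_n. Otherwise there is a null sequence of nonzero
    points y_n; the Hausdorff property gives an open neighbourhood V_n of y_n
    whose closure misses 0. Put P_n = (y_n + U_n) /\ V_n. Since y_n adheres to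
    y_n + U_n, it adheres to P_n, so 0 adheres to the union of the P_n and is the
    limit of points z_k with z_k in P_(m_k). Because 0 is outside the closure of
    each V_n, every index n is taken by finitely many k only, so m_k tends to
    infinity, and along a subsequence on which m increases strictly the points
    z_k - y_(m_k) lie in U_(m_k) and tend to 0
    ([kappa_frechet_urysohn_diagonal_at0]). *)

(** * Translations in a topological abelian group *)

Section translations.
Context {M : topologicalZmodType}.

Lemma cvg_addz (T : Type) (F : set_system T) (FF : Filter F) (f g : T -> M)
    (a b : M) : f @ F --> a -> g @ F --> b -> (fun t => f t + g t) @ F --> a + b.
Proof. by move=> fa gb; apply: cvg_comp2 fa gb (add_continuous (a, b)). Qed.

Lemma addr_continuousl (a : M) : continuous (fun x : M => x + a).
Proof. by move=> x; apply: cvg_addz; [exact: cvg_id | exact: cvg_cst]. Qed.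

Lemma nbhs_addr (x : M) (A : set M) :
  nbhs x A <-> nbhs 0 [set v | A (v + x)].
Proof.
split=> nA.
  by have := addr_continuousl x 0; rewrite /continuous_at add0r; exact.
have := addr_continuousl (- x) x; rewrite /continuous_at subrr => /(_ _ nA) nAx.
have : \forall y \near x, A (y - x + x) by exact: nAx.
by apply: filterS => y; rewrite subrK.
Qed.

Lemma open_addr (a : M) (A : set M) : open A -> open [set v | A (v + a)].
Proof. by move=> oA; apply: open_comp oA => x _; exact: addr_continuousl. Qed.

Lemma closure_addr (x : M) (A : set M) :
  closure A x -> closure [set v | A (v + x)] 0.
Proof.
move=> clA B B0.
have [|y [Ay By]] := clA [set y | B (y - x)].
  by apply/nbhs_addr; apply: filterS B0 => v /=; rewrite addrK.
by exists (y - x); split=> //=; rewrite subrK.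
Qed.

End translations.

(** * Complete regularity of topological abelian groups *)

(** A type alias, so that the translation-invariant uniformity does not compete
    with a uniform structure that an instance of M may carry already. *)
Definition group_uniform (M : topologicalZmodType) : Type := M.

Section group_uniformity.
Context {M : topologicalZmodType}.

Definition difference_entourage : set_system (M * M) :=
  [set A | exists2 V : set M, nbhs 0 V &
     [set xy | V (xy.2 - xy.1)] `<=` A].

Lemma difference_entourage_filter : Filter difference_entourage.
Proof.
split; first by exists setT => //; exact: filterT.
  move=> A B [V V0 VA] [W W0 WB]; exists (V `&` W); first exact: filterI.
  by move=> xy [Vxy Wxy]; split; [exact: VA | exact: WB].
by move=> A B AB [V V0 VA]; exists V => //; exact: subset_trans AB.
Qed.

Lemma difference_entourage_diagonal A :
  difference_entourage A -> diagonal `<=` A.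
Proof.
move=> [V V0 VA] xy xyE; apply: VA => /=.
by rewrite xyE subrr; exact: nbhs_singleton.
Qed.

Lemma difference_entourage_inv A :
  difference_entourage A -> difference_entourage (A^-1)%relation.
Proof.
move=> [V V0 VA]; exists [set v | V (- v)].
  by have := @opp_continuous M 0; rewrite /continuous_at oppr0; exact.
by move=> [x y] /= Vxy; apply: VA; rewrite /= -opprB.
Qed.

(** Halving an entourage is continuity of addition at (0, 0), applied to
    y - x = (y - z) + (z - x). *)
Lemma difference_entourage_split A : difference_entourage A ->
  exists2 B, difference_entourage B & (B \; B)%relation `<=` A.
Proof.
move=> [V V0 VA].
have := @add_continuous M (0, 0); rewrite /continuous_at /= addr0.
move=> /(_ _ V0)[[W1 W2]/= [W10 W20] WV].
exists [set xy | (W1 `&` W2) (xy.2 - xy.1)].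
  by exists (W1 `&` W2) => //; exact: filterI.
move=> [x y] /= [z [_ W2zx] [W1yz _]]; apply: VA => /=.
by rewrite -(subrKA z); exact: (WV (y - z, z - x)).
Qed.

Lemma nbhs_difference_entourage :
  nbhs = nbhs_ difference_entourage :> (M -> _).
Proof.
apply/funext => x; apply/seteqP; split=> A.
  move/nbhs_addr => nA; exists [set xy | A (xy.2 - xy.1 + x)].
    by exists [set v | A (v + x)].
  by move=> y /xsectionP /=; rewrite subrK.
move=> [B [V V0 VB] BA]; apply/nbhs_addr; apply: filterS V0 => v Vv.
by apply/BA/xsectionP/VB => /=; rewrite addrK.
Qed.

HB.instance Definition _ := Topological.on (group_uniform M).
HB.instance Definition _ := Nbhs_isUniform_mixin.Build (group_uniform M)
  difference_entourage_filter difference_entourage_diagonal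
  difference_entourage_inv difference_entourage_split
  nbhs_difference_entourage.

(** A uniform space separates a point from a closed set by an entourage whose
    section at the point misses the set. *)
Lemma topologicalZmod_completely_regular : completely_regular_space M.
Proof.
move=> x B clB nBx.
have : nbhs (x : group_uniform M) (~` B).
  by apply: open_nbhs_nbhs; split=> //; exact: closed_openC.
rewrite -nbhs_entourageE => -[A entA AB].
exists (Uniform.class (group_uniform M)), A; split => //; last by move=> y.
rewrite -subset0 => -[_ y] [/= [-> By] Axy].
by apply: (AB y) => //; exact/xsectionP.
Qed.

End group_uniformity.

(** * Subsequences *)

Lemma strictly_increasing_cvgny (s : nat -> nat) :
  {homo s : i j / (i < j)%N} -> s n @[n --> \oo] --> \oo.
Proof.
move=> s_incr; apply/cvgnyPge => A; exists A => // n /= An.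
apply: leq_trans An _; elim: n => // n IHn.
by apply: leq_ltn_trans IHn _; exact: s_incr.
Qed.

(** From any index p some later q has m q > m p, since m exceeds m p
    eventually; iterating such a choice makes both phi and m \o phi strictly
    increase. *)
Lemma cvgny_increasing_subsequence (m : nat -> nat) :
  m n @[n --> \oo] --> \oo ->
  exists2 phi : nat -> nat, {homo phi : i j / (i < j)%N} &
    {homo m \o phi : i j / (i < j)%N}.
Proof.
move=> /cvgnyPgt moo.
have /choice[f f_gt] : forall p, exists q, (p < q)%N /\ (m p < m q)%N.
  move=> p; have [N _ mN] := moo (m p); exists (maxn N p.+1).
  by rewrite leq_maxr; split => //; apply: mN; exact: leq_maxl.
exists (fun k => iter k f 0%N); apply: homo_ltn => [y x z|i /=].
- exact: ltn_trans.
- by case: (f_gt (iter i f 0%N)).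
- exact: ltn_trans.
- by case: (f_gt (iter i f 0%N)).
Qed.

(** * Diagonal sequences at the origin *)

(** The last clause says that q is outside the closure of V; this is what
    bounds how often a sequence converging to q can visit V. *)
Lemma hausdorff_neighborhood_away (T : topologicalType) (p q : T) :
  hausdorff_space T -> p != q ->
  exists V : set T, [/\ open V, V p & \forall z \near q, ~ V z].
Proof.
move=> + pq; rewrite open_hausdorff => /(_ _ _ pq)[[A B] /= [Ap Bq] [oA oB AB]].
exists A; split => //; first exact: set_mem.
apply: filterS (open_nbhs_nbhs (conj oB (set_mem Bq))) => z Bz Az.
by have : (A `&` B) z by []; rewrite (eqP AB).
Qed.

Section kappa_frechet_urysohn_groups.
Context {M : topologicalZmodType}.

Definition frechet_urysohn_diagonal_at0 :=
  forall U : nat -> set M,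
    (forall n, open (U n)) -> (forall n, closure (U n) 0) ->
    exists (s : nat -> nat) (x : nat -> M),
      [/\ {homo s : i j / (i < j)%N}, forall k, U (s k) (x k) &
          x k @[k --> \oo] --> (0 : M)].

(** The sets U n may all be equal, so the diagonal property contains the
    sequential approximation of 0 from a single open set; translations carry it
    to every other point. *)
Lemma diagonal_at0_kappa_frechet_urysohn :
  hausdorff_space M -> frechet_urysohn_diagonal_at0 -> kappa_frechet_urysohn M.
Proof.
move=> hM diag; split.
  by split => //; exact: topologicalZmod_completely_regular.
move=> U x oU clUx.
have [|_|s [v [_ Uv v0]]] := diag (fun=> [set v | U (v + x)]).
- by move=> _; exact: open_addr.
- exact: closure_addr.
exists (fun n => v n + x); first exact: Uv.
by rewrite -[X in _ --> X]add0r; apply: cvg_addz v0 _; exact: cvg_cst.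
Qed.

(** The complement of 0 is open, and 0 adheres to it because it is not
    isolated. *)
Lemma kappa_frechet_urysohn_null_sequence :
  kappa_frechet_urysohn M -> ~ nbhs (0 : M) [set 0] ->
  exists2 y : nat -> M, (forall n, y n != 0) & y n @[n --> \oo] --> (0 : M).
Proof.
move=> [[hM _] kM] not_isolated.
have [||y y0 cy] := kM (~` [set 0]) 0.
- apply/closed_openC/accessible_closed_set1; exact: hausdorff_accessible.
- rewrite closure_setC; exact: not_isolated.
by exists y => // n; apply/eqP; exact: y0.
Qed.

(** The translates y n + U n, with y a null sequence of nonzero points, can be
    glued into one open set adherent to 0 in which each piece stays away from 0;
    a sequence in that set converging to 0 must then leave every piece. *)
Lemma kappa_frechet_urysohn_diagonal_at0 :
  kappa_frechet_urysohn M -> frechet_urysohn_diagonal_at0.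
Proof.
move=> kM U oU clU.
have [isolated|not_isolated] := pselect (nbhs (0 : M) [set 0]).
  exists id, (fun=> 0); split=> [//|k|]; last exact: cvg_cst.
  by have [w [Ukw /= w0]] := clU k _ isolated; rewrite -w0.
have [y y_neq0 y_cvg0] := kappa_frechet_urysohn_null_sequence kM not_isolated.
have [[hM _] seqM] := kM.
have /choice[V VP] : forall n, exists V : set M,
    [/\ open V, V (y n) & \forall z \near 0, ~ V z].
  by move=> n; exact: hausdorff_neighborhood_away.
pose P n := [set z | U n (z - y n)] `&` V n.
have oP n : open (P n).
  by have [oV _ _] := VP n; apply: openI oV; exact: open_addr.
have clP : closure (\bigcup_n P n) 0.
  move=> N; rewrite nbhsE => -[N' [oN' N'0] N'N].
  have [k _ /(_ k (leqnn k)) N'yk] := y_cvg0 _ (open_nbhs_nbhs (conj oN' N'0)).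
  have [oV Vy _] := VP k.
  have /nbhs_addr N'V : nbhs (y k) (N' `&` V k).
    by apply: open_nbhs_nbhs; split; [exact: openI | ].
  have [v [Uv [N'v Vv]]] := clU k _ N'V.
  exists (v + y k); split; last exact: N'N.
  by exists k => //; split => //=; rewrite addrK.
have [z zP z_cvg0] := seqM _ 0 (bigcup_open (fun n _ => oP n)) clP.
have /choice[m mP] : forall k, exists n, P n (z k).
  by move=> k; have [n _ Pn] := zP k; exists n.
(* The finitely many V i with i <= A are all left eventually by z. *)
have m_cvgny : m k @[k --> \oo] --> \oo.
  apply/cvgnyPgt => A.
  have : \forall k \near \oo, forall i : 'I_A.+1, ~ V i (z k).
    by apply: filter_forall => i; have [_ _ /z_cvg0] := VP i.
  apply: filterS => k notV; rewrite ltnNge.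
  apply/negP => mA; have [_ Vzk] := mP k.
  by apply: (notV (Ordinal (mA : (m k < A.+1)%N))).
have [phi phi_incr mphi_incr] :=
  cvgny_increasing_subsequence _ m_cvgny.
exists (m \o phi), (fun k => z (phi k) - y (m (phi k))); split=> // [k|].
  by have [] := mP (phi k).
rewrite -[X in _ --> X]subr0.
apply: cvg_addz.
  by apply: cvg_comp z_cvg0; exact: strictly_increasing_cvgny.
apply: (@cvg_comp _ _ _ (y \o (m \o phi)) -%R _ (nbhs (0 : M))).
  by apply: cvg_comp y_cvg0; exact: strictly_increasing_cvgny.
exact: opp_continuous.
Qed.

End kappa_frechet_urysohn_groups.

Theorem theorem3p1 (K : numFieldType) (E : topologicalLmodType K)
    (hausE : hausdorff_space E) :
  (forall U : nat -> set E,
      (forall n, open (U n)) -> (forall n, closure (U n) 0) ->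
      exists (s : nat -> nat) (x : nat -> E),
        [/\ {homo s : i j / (i < j)%N},
            forall k, U (s k) (x k) &
            x k @[k --> \oo] --> (0 : E)])
  <-> kappa_frechet_urysohn E.
Proof.
split.
  exact: diagonal_at0_kappa_frechet_urysohn.
exact: kappa_frechet_urysohn_diagonal_at0.
Qed.
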